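(* Let $(X,d)$ be a complete separable metric space, let $(\Xi,\mathcal{A},\mathbb{P})$ be a complete probability space, let $(\Xi^\infty,\mathcal{A}^\infty,\mathbb{P}^\infty)$ be its denumerable product, and let $M:\Xi\rightrightarrows X$ be a measurable multifunction with closed values. Let $g:X\to\mathbb{R}\cup\{+\infty\}$ be lower semicontinuous, and let $g_n:X\to\mathbb{R}\cup\{+\infty\}$, $n\in\mathbb{N}$, be lower semicontinuous functions converging continuously to $g$. Put $M_{as}:=\{x\in X: x\in M(\xi)\text{ for }\mathbb{P}\text{-almost every }\xi\}$ and $S_n(\omega):=\bigcap_{k=1}^nM(\xi_k)$ for $\omega=(\xi_k)_{k=1}^\infty\in\Xi^\infty$, $n\ge1$. Assume that the problem of minimizing $g$ over $M_{as}$ is feasible (there is $x\in M_{as}$ with $g(x)<+\infty$), and that for $\mathbb{P}^\infty$-almost every $\omega\in\Xi^\infty$ the sequence $(g_n)$ is eventually level-compact on $(S_n(\omega))_n$. Then: (a) $\lim_{n\to\infty}v(g_n,S_n(\omega))=v(g,M_{as})$ for $\mathbb{P}^\infty$-almost every $\omega$. (b) For any sequence of measurable functions $\epsilon_n:\Xi^\infty\to(0,+\infty)$ with $\epsilon_n\to0$ $\mathbb{P}^\infty$-almost surely, $$\emptyset\ne\limsup_{n\to\infty}\ \epsilon_n(\omega)\text{-}\mathrm{argmin}_{S_n(\omega)}\,g_n\subseteq\mathrm{argmin}_{M_{as}}\,g\quad\text{for }\mathbb{P}^\infty\text{-almost every }\omega.$$ (c) For $\mathbb{P}^\infty$-almost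 every $\omega$, $$\bigcap_{\epsilon>0}\liminf_{n\to\infty}\ \epsilon\text{-}\mathrm{argmin}_{S_n(\omega)}\,g_n=\mathrm{argmin}_{M_{as}}\,g=\bigcap_{\epsilon>0}\limsup_{n\to\infty}\ \epsilon\text{-}\mathrm{argmin}_{S_n(\omega)}\,g_n.$$
   Context: A multifunction $M:\Xi\rightrightarrows X$ assigns to each $\xi$ a subset $M(\xi)\subseteq X$; it is measurable if $\{\xi\in\Xi: M(\xi)\cap U\ne\emptyset\}\in\mathcal{A}$ for every open $U\subseteq X$. Functions $h_n:X\to\mathbb{R}\cup\{+\infty\}$ converge continuously to $h$ if $\lim_n h_n(x_n)=h(x)$ for every $x\in X$ and every sequence $x_n\to x$. A sequence of functions $h_n$ is eventually level-compact on a sequence of sets $C_n\subseteq X$ if for each $\alpha\in\mathbb{R}$ there is $n_\alpha\in\mathbb{N}$ such that $\bigcup_{n\ge n_\alpha}\{x\in C_n: h_n(x)\le\alpha\}$ is relatively compact. For $h:X\to\mathbb{R}\cup\{+\infty\}$, $C\subseteq X$ and $\epsilon\ge0$: $v_\epsilon(h,C):=\inf_C h+\epsilon$ if $\inf_C h>-\infty$, and $v_\epsilon(h,C):=-1/\epsilon$ if $\inf_C h=-\infty$, with the convention $1/0=+\infty$; $\epsilon\text{-}\mathrm{argmin}_C\,h:=\{x\in C:h(x)\le v_\epsilon(h,C)\}$. When $\epsilon=0$ the symbol $\epsilon$ is omitted: $v(h,C)=\inf_C h$ and $\mathrm{argmin}_C\,h=\{x\in C:h(x)\le\inf_C h\}$.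 For sets $S_n\subseteq X$, the Painlevé–Kuratowski limits are $\liminf_{n\to\infty}S_n:=\{x\in X:\limsup_{n\to\infty}d(x,S_n)=0\}$ and $\limsup_{n\to\infty}S_n:=\{x\in X:\liminf_{n\to\infty}d(x,S_n)=0\}$, where $d(x,S_n)=\inf\{d(x,y):y\in S_n\}$ and $\inf\emptyset=+\infty$. *)

(* Defs.v *)
From HB Require Import structures.
From mathcomp Require Import all_boot all_order all_algebra.
From mathcomp Require Import all_classical all_reals all_analysis.

Set Implicit Arguments.
Unset Strict Implicit.
Unset Printing Implicit Defensive.

Import Order.TTheory GRing.Theory Num.Theory.
Import numFieldNormedType.Exports.

Local Open Scope classical_set_scope.
Local Open Scope ring_scope.
Local Open Scope ereal_scope.

Definition complete_space {R : realType} (X : metricType R) : Prop :=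
  forall u : nat -> X, cauchy (u @ \oo) -> exists l : X, u @ \oo --> l.

Definition separable_space (X : topologicalType) : Prop :=
  exists2 D : set X, countable D & dense D.

Definition measurable_multifunction {d : measure_display}
    {Xi : measurableType d} {X : topologicalType} (M : Xi -> set X) : Prop :=
  forall U : set X, open U -> measurable [set xi | M xi `&` U !=set0].

(** Functions with values in R u {+oo} are maps to [\bar R] avoiding -oo. *)
Definition avoids_ninfty {R : realType} {X : Type} (h : X -> \bar R) : Prop :=
  forall x, h x != -oo.

Definition converges_continuously {R : realType} {X : topologicalType}
    (h_ : nat -> X -> \bar R) (h : X -> \bar R) : Prop :=
  forall (x : X) (u : nat -> X), u @ \oo --> x ->
    (fun n => h_ n (u n)) @ \oo --> h x.

(** Relative compactness is [precompact]: see [precompactE]. *)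
Definition eventually_level_compact {R : realType} {X : topologicalType}
    (h_ : nat -> X -> \bar R) (C : nat -> set X) : Prop :=
  forall a : R, exists n0 : nat,
    precompact (\bigcup_(n in [set n | (n0 <= n)%N])
                  [set x | C n x /\ h_ n x <= a%:E]).

Definition value {R : realType} {X : Type} (h : X -> \bar R) (C : set X)
    : \bar R :=
  ereal_inf (h @` C).

(** The convention 1/0 = +oo is spelled out because 0^-1 = 0 in [R]. *)
Definition eps_value {R : realType} {X : Type} (e : R) (h : X -> \bar R)
    (C : set X) : \bar R :=
  if value h C == -oo then (if e == 0%R then -oo else (- e^-1)%:E)
  else value h C + e%:E.

Definition eps_argmin {R : realType} {X : Type} (e : R) (h : X -> \bar R)
    (C : set X) : set X :=
  [set x | C x /\ h x <= eps_value e h C].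

Definition argmin {R : realType} {X : Type} (h : X -> \bar R) (C : set X)
    : set X :=
  [set x | C x /\ h x <= value h C].

Definition dist_to {R : realType} {X : metricType R} (x : X) (S : set X)
    : \bar R :=
  ereal_inf [set (mdist x y)%:E | y in S].

Definition PK_liminf {R : realType} {X : metricType R} (S : nat -> set X)
    : set X :=
  [set x | limn_esup (fun n => dist_to x (S n)) = 0].

Definition PK_limsup {R : realType} {X : metricType R} (S : nat -> set X)
    : set X :=
  [set x | limn_einf (fun n => dist_to x (S n)) = 0].

Definition coordinate_cylinders {d : measure_display} (Xi : measurableType d)
    : set (set (nat -> Xi)) :=
  [set C | exists (k : nat) (A : set Xi),
             measurable A /\ C = [set w | A (w k)]].

(** The space of sequences in [Xi] with the product sigma-algebra; a notation
    so that the [measurableType] instance is inferred. *)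
Notation sequence_space Xi :=
  (g_sigma_algebraType (@coordinate_cylinders _ Xi)).

(** By uniqueness of extension from cylinders, at most one probability measure
    on the product sigma-algebra satisfies this. *)
Definition is_denumerable_product {d : measure_display}
    {Xi : measurableType d} {R : realType} (P : probability Xi R)
    (Pinf : probability (sequence_space Xi) R) : Prop :=
  forall (n : nat) (A : nat -> set Xi), (forall k, measurable (A k)) ->
    Pinf [set w : nat -> Xi | forall k, (k < n)%N -> A k (w k)] =
    \prod_(k < n) P (A k).

Definition as_set {d : measure_display} {Xi : measurableType d}
    {R : realType} {X : Type} (P : probability Xi R) (M : Xi -> set X)
    : set X :=
  [set x | {ae P, forall xi, M xi x}].

(** The entry [w k] is the sample xi_(k+1), so this is the intersection of
    M(xi_1), ..., M(xi_n); for [n = 0] it is the whole space, which is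
    irrelevant to the asymptotic notions used. *)
Definition sampled_set {Xi X : Type} (M : Xi -> set X) (w : nat -> Xi)
    (n : nat) : set X :=
  \bigcap_(k in [set k | (k < n)%N]) M (w k).

(* Main.v *)
(** Almost surely the sets S_n(w) decrease to exactly M_as. For the inclusion of
    M_as in every M(xi_k), test closed sets against a countable base: if a basic
    open set U meets M_as then M(xi) meets U for almost every xi. Conversely a
    point outside M_as lies in some basic U with P(M meets U) < 1, so almost
    surely some M(xi_k) misses U. What remains is deterministic: level-compactness
    yields cluster points of approximate minimizers, these lie in the
    intersection of the closed decreasing sets S_n(w), and continuous convergence
    bounds g there by the limit of the approximate values. *)

Require Import Defs.
From HB Require Import structures.
From mathcomp Require Import all_boot all_order all_algebra.
From mathcomp Require Import all_classical all_reals all_analysis.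

Import Order.TTheory GRing.Theory Num.Theory.
Import numFieldNormedType.Exports.

Local Open Scope classical_set_scope.
Local Open Scope ring_scope.
Local Open Scope ereal_scope.

Set Implicit Arguments.
Unset Strict Implicit.

(** * Cluster points under continuous convergence and level-compactness *)

(** The Painleve-Kuratowski upper limit in topological form, free of distances; see [PK_limsupE]. *)
Definition cluster_points {X : topologicalType} (B : nat -> set X) : set X :=
  [set x | forall U, nbhs x U -> forall N,
     exists2 n, (N <= n)%N & B n `&` U !=set0].

(** Otherwise there are points ever closer to [x], at ever larger indices, whose values avoid [V];
    merged into one sequence tending to [x], they contradict continuous convergence. *)
Lemma converges_continuously_near {R : realType} {X : metricType R}
    (h_ : nat -> X -> \bar R) (h : X -> \bar R) (x : X) (V : set (\bar R)) :
  converges_continuously h_ h -> nbhs (h x) V ->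
  exists2 U, nbhs x U & \forall n \near \oo, forall y, U y -> V (h_ n y).
Proof.
move=> hh Vhx; apply: contrapT => noU.
have bad k : exists p : nat * X,
    [/\ (k <= p.1)%N, ball x k.+1%:R^-1 p.2 & ~ V (h_ p.1 p.2)].
  apply: contrapT => nobad; apply: noU; exists (ball x k.+1%:R^-1).
    by apply: nbhsx_ballx; rewrite invr_gt0.
  exists k => // n /= kn y xy; apply: contrapT => nV.
  by apply: nobad; exists (n, y).
have [p pP] := choice bad.
(* The indices [k < K] give finitely many values [(p k).1]; past these, [u n]
   is either [x] or some [(p k).2] with [K <= k], so [u] tends to [x]. *)
pose u n := if pselect (exists k, (p k).1 = n) is left e
  then (p (sval (cid e))).2 else x.
have ux : u @ \oo --> x.
  apply/cvg_ballP => e e0.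
  have [K _ Ke] := near_infty_natSinv_lt (PosNum e0).
  exists (\max_(k < K) (p k).1).+1 => // n /= Kn; rewrite /u.
  case: pselect => [E|_]; last exact: ballxx.
  case: cid => k /= kn; have [_ + _] := pP k; apply: le_ball.
  rewrite ltW// (Ke k)//= leqNgt; apply/negP => kK.
  by move: Kn; rewrite ltnNge -kn (leq_bigmax (Ordinal kK)).
have [N _ NV] := hh x u ux _ Vhx.
(* At index [(p N).1] the choice inside [u] may return some [k] other than [N], but every candidate
   is a bad point for that same index. *)
have [Np _ _] := pP N; have := NV _ Np; rewrite /= /u.
case: pselect => [E|[]]; last by exists N.
by case: cid => k /= kn; have [_ _] := pP k; rewrite kn.
Qed.

(** If [a < h x], then for large [n] the functions [h_ n] exceed [a] on one fixed neighbourhood of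
    [x], which [B n] must then miss. *)
Lemma cluster_points_le {R : realType} {X : metricType R}
    (h_ : nat -> X -> \bar R) (h : X -> \bar R) (B : nat -> set X) (a : R)
    (x : X) :
  converges_continuously h_ h ->
  (\forall n \near \oo, forall y, B n y -> h_ n y <= a%:E) ->
  cluster_points B x -> h x <= a%:E.
Proof.
move=> hh Ba xB; rewrite leNgt; apply/negP => ahx.
have [U Ux UV] := converges_continuously_near hh (open_ereal_gt' ahx).
have [N _ BU] : \forall n \near \oo, forall y, B n y -> ~ U y.
  near=> n => y Bny Uy; have : h_ n y <= a%:E by move: y Bny {Uy}; near: n.
  by apply/negP; rewrite -ltNge; move: y Uy {Bny}; near: n.
by have [n Nn [y [By Uy]]] := xB _ Ux N; exact: (BU n Nn y).
Unshelve. all: by end_near. Qed.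

(** For fixed [m] all late [B n] lie in [C m], so a cluster point is adherent to the closed set
    [C m]. *)
Lemma cluster_points_bigcap {X : topologicalType} (C B : nat -> set X) :
  (forall n, closed (C n)) ->
  (forall m n, (m <= n)%N -> C n `<=` C m) ->
  (\forall n \near \oo, B n `<=` C n) ->
  cluster_points B `<=` \bigcap_n C n.
Proof.
move=> Ccl Cni [N _ BC] x xB m _; apply: Ccl => U Ux.
have [n mn [y [By Uy]]] := xB U Ux (maxn N m); exists y; split => //.
move: mn; rewrite geq_max => /andP[Nn mn].
exact: (Cni m n mn) (BC n Nn _ By).
Qed.

(** Points picked from [B n] at arbitrarily large [n] all lie in one relatively compact union of
    level sets, so the picked sequence clusters. *)
Lemma cluster_points_neq0 {R : realType} {X : topologicalType}
    (h_ : nat -> X -> \bar R) (C B : nat -> set X) (a : R) :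
  eventually_level_compact h_ C ->
  (\forall n \near \oo, forall y, B n y -> C n y /\ h_ n y <= a%:E) ->
  (forall N, exists2 n, (N <= n)%N & B n !=set0) ->
  cluster_points B !=set0.
Proof.
move=> /(_ a)[n0 K] [n1 _ BC] Bfreq.
have pick k : exists p : nat * X,
    [/\ (k <= p.1)%N, (n0 <= p.1)%N, (n1 <= p.1)%N & B p.1 p.2].
  have [n + [y By]] := Bfreq (maxn k (maxn n0 n1)).
  by rewrite !geq_max => /and3P[? ? ?]; exists (n, y).
have [p pP] := choice pick.
move: K; rewrite precompactE => /(_ ((fun k => (p k).2) @ \oo) _)[|x [_ xp]].
  exists 0%N => // k _ /=; apply: subset_closure.
  have [_ n0p n1p Bp] := pP k; exists (p k).1 => //=.
  exact: BC n1p _ Bp.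
exists x => U Ux N.
have [|y [[n Nn Bny] Uy]] :=
    xp [set y | exists2 n, (N <= n)%N & B n y] U _ Ux.
  exists N => // k /= Nk; have [kp _ _ Bp] := pP k.
  by exists (p k).1 => //; exact: leq_trans kp.
by exists n => //; exists y.
Qed.

(** * Painleve-Kuratowski limits *)

Section painleve_kuratowski.
Context {R : realType} {X : metricType R}.
Implicit Types (B : nat -> set X) (x : X).

Lemma dist_to_ge0 x (A : set X) : 0 <= dist_to x A.
Proof. by apply: le_ereal_inf_tmp => _ [y _ <-]; rewrite lee_fin mdist_ge0. Qed.

Lemma dist_to_mem x (A : set X) : A x -> dist_to x A = 0.
Proof.
move=> Ax; apply/eqP; rewrite eq_le dist_to_ge0 andbT.
by apply: ereal_inf_lbound; exists x => //; rewrite mdistxx.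
Qed.

Lemma limn_einf_sup_einfs (u : nat -> \bar R) :
  limn_einf u = ereal_sup (range (einfs u)).
Proof. by rewrite limn_einf_lim; apply/cvg_lim => //; exact: cvg_einfs_sup. Qed.

(** Distances are nonnegative, so their lower limit is 0 exactly when every tail infimum is 0, that
    is, when every ball around [x] meets [B n] for arbitrarily large [n]. *)
Lemma PK_limsupE B : PK_limsup B = cluster_points B.
Proof.
rewrite /PK_limsup; apply/seteqP; split => x /=; rewrite limn_einf_sup_einfs.
  move=> sup0 U /nbhs_ballP[e /= e0 eU] N.
  have : einfs (fun n => dist_to x (B n)) N < e%:E.
    apply: (@le_lt_trans _ _ 0); last by rewrite lte_fin.
    by rewrite -sup0; apply: ereal_sup_ubound; exists N.
  move=> /ereal_inf_lt[_ [n /= Nn <-]] /ereal_inf_lt[_ [y By <-]].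
  rewrite lte_fin => xye; exists n => //; exists y; split => //.
  by apply: eU; rewrite ballEmdist.
move=> xB; apply/eqP; rewrite eq_le; apply/andP; split; last first.
  apply: le_trans (ereal_sup_ubound _); last by exists 0%N.
  by apply: le_ereal_inf_tmp => _ [n _ <-]; exact: dist_to_ge0.
apply: ge_ereal_sup => _ [N _ <-]; apply/lee_addgt0Pr => e e0; rewrite add0e.
have [n Nn [y [By]]] := xB _ (nbhsx_ballx x e e0) N.
rewrite ballEmdist/= => xye.
apply: (@le_trans _ _ (dist_to x (B n))).
  by apply: ereal_inf_lbound; exists n.
apply: (@le_trans _ _ (mdist x y)%:E); last by rewrite lee_fin ltW.
by apply: ereal_inf_lbound; exists y.
Qed.

Lemma PK_liminf_sub_limsup B : PK_liminf B `<=` PK_limsup B.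
Proof.
rewrite /PK_liminf /PK_limsup => x /= sup0; apply/eqP; rewrite eq_le.
apply/andP; split; first by apply: le_trans (limn_einf_sup _) _; rewrite sup0.
rewrite limn_einf_sup_einfs.
apply: le_trans (ereal_sup_ubound _); last by exists 0%N.
by apply: le_ereal_inf_tmp => _ [n _ <-]; exact: dist_to_ge0.
Qed.

Lemma near_PK_liminf B x : (\forall n \near \oo, B n x) -> PK_liminf B x.
Proof.
rewrite /PK_liminf /= => Bx; suff /cvg_limn_einf_sup[_ ->] :
  (fun n => dist_to x (B n)) @ \oo --> (0 : \bar R) by [].
by apply: cvg_near_cst; apply: filterS Bx => n /dist_to_mem.
Qed.

End painleve_kuratowski.

(** * Deterministic minimization over decreasing closed sets *)

Section decreasing_constraints.
Context {R : realType} {X : metricType R}.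
Context (g_ : nat -> X -> \bar R) (g : X -> \bar R) (C : nat -> set X).
Context (g_cvg : converges_continuously g_ g) (g_val : avoids_ninfty g).
Context (C_closed : forall n, closed (C n)).
Context (C_nincr : forall m n, (m <= n)%N -> C n `<=` C m).
Context (g_lc : eventually_level_compact g_ C).
Local Notation S := (\bigcap_n C n).
Context (S_feasible : exists2 x, S x & g x < +oo).

Let cvg_pointwise x : (fun n => g_ n x) @ \oo --> g x.
Proof. by apply: (@g_cvg x (fun=> x)); exact: cvg_cst. Qed.

Let value_lb n x : C n x -> value (g_ n) (C n) <= g_ n x.
Proof. by move=> Cx; apply: ereal_inf_lbound; exists x. Qed.

(** A point [x] of [S] with [g x < r] is feasible for every [n], and [g_ n x] tends to [g x]; this
    controls the approximate values from above. *)
Lemma near_eps_value_lt (eps : nat -> R) (r : R) :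
  (forall n, (0 < eps n)%R) -> eps @ \oo --> (0 : R)%R ->
  value g S < r%:E ->
  \forall n \near \oo, eps_value (eps n) (g_ n) (C n) < r%:E.
Proof.
move=> eps0 epsc /ereal_inf_lt[_ [x Sx <-]].
have := g_val x; case gx : (g x) => [s| |] // _; rewrite lte_fin => sr.
pose m := ((s + r) / 2)%R.
have [sm mr] : (s < m)%R /\ (m < r)%R by rewrite /m midf_lt// midf_lt.
have gm : \forall n \near \oo, g_ n x < m%:E.
  by apply: (@cvg_pointwise x _ (open_ereal_lt' _)); rewrite gx lte_fin.
(* The bound [r - m] serves the case of a value above [-oo], where [eps n] must fit in the gap
   between [m] and [r]; the other bound serves the value [-oo], forcing [- (eps n)^-1] below [r]. *)
have epsm : \forall n \near \oo, (eps n <= Num.min (r - m) (`|r| + 1)^-1)%R.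
  have mpos : (0 < Num.min (r - m) (`|r| + 1)^-1)%R.
    by rewrite lt_min subr_gt0 mr invr_gt0 ltr_wpDl.
  move/cvgrPdist_le : epsc => /(_ _ mpos); apply: filterS => n.
  by rewrite sub0r normrN gtr0_norm.
apply: filterS2 gm epsm => n gnm em.
move: em; rewrite le_min => /andP[em er]; rewrite /eps_value (gt_eqF (eps0 n)).
case: ifPn => _.
  rewrite lte_fin ltrNl; apply: (@lt_le_trans _ _ (`|r| + 1)%R).
    by rewrite (le_lt_trans (ler_norm _))// normrN ltrDl.
  by rewrite -[leLHS]invrK lef_pV2// posrE// invr_gt0 ltr_wpDl.
apply: (@lt_le_trans _ _ (m%:E + (eps n)%:E)).
  by rewrite lteD2rE//; apply: le_lt_trans gnm; apply: value_lb; exact: Sx.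
by rewrite -EFinD lee_fin -lerBrDl.
Qed.

(** For [e > 0] the threshold [eps_value e h A] lies strictly above the infimum, also when the
    infimum is [-oo]. *)
Lemma eps_argmin_neq0 (e : R) (h : X -> \bar R) (A : set X) :
  (0 < e)%R -> value h A < +oo -> eps_argmin e h A !=set0.
Proof.
move=> e0 Aoo; have : value h A < eps_value e h A.
  rewrite /eps_value (gt_eqF e0); case: ifPn => [/eqP ->|]; first exact: ltNyr.
  by move=> AN; rewrite lteDl// fin_numE AN lt_eqF.
by move=> /ereal_inf_lt[_ [x Ax <-]] /ltW hx; exists x.
Qed.

Lemma near_value_lty : \forall n \near \oo, value (g_ n) (C n) < +oo.
Proof.
have [x Sx gx] := S_feasible.
have : \forall n \near \oo, g_ n x < +oo.
  exact: (@cvg_pointwise x _ (open_ereal_lt' gx)).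
by apply: filterS => n; apply: le_lt_trans; apply: value_lb; exact: Sx.
Qed.

(** The bound on [g x] goes through reals [r] above the value because finiteness of [value g S] is
    itself derived from this lemma. *)
Lemma cluster_eps_argmin (eps : nat -> R) :
  (forall n, (0 < eps n)%R) -> eps @ \oo --> (0 : R)%R ->
  let L := cluster_points (fun n => eps_argmin (eps n) (g_ n) (C n)) in
  L !=set0 /\ (forall x, L x -> S x /\
    forall r : R, value g S < r%:E -> g x <= r%:E).
Proof.
move=> eps0 epsc L; split; last first.
  move=> x Lx; split.
    apply: (cluster_points_bigcap C_closed C_nincr _ Lx).
    by near=> n; move=> y [].
  move=> r /(near_eps_value_lt eps0 epsc) Hr.
  apply: (cluster_points_le g_cvg _ Lx).
  by apply: filterS Hr => n /ltW er y [_] /le_trans; apply.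
have [x Sx gxoo] := S_feasible.
(* This [r] is the level at which level-compactness is applied. *)
have [r vr] : exists r : R, value g S < r%:E.
  have := g_val x; case gx : (g x) gxoo => [s| |] // _ _.
  exists (s + 1)%R; apply: (@le_lt_trans _ _ s%:E).
    by rewrite -gx; apply: ereal_inf_lbound; exists x.
  by rewrite lte_fin ltrDl.
apply: (cluster_points_neq0 (a := r) g_lc).
  apply: filterS (near_eps_value_lt eps0 epsc vr) => n /ltW er y [Cy yr].
  by split => //; exact: le_trans er.
have [N0 _ H] := near_value_lty.
move=> N; exists (maxn N N0); first exact: leq_maxl.
by apply: eps_argmin_neq0 => //; apply: H; exact: leq_maxr.
Unshelve. all: by end_near. Qed.

Lemma value_fin_num : value g S \is a fin_num.
Proof.
have [x0 Sx0 gx0] := S_feasible.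
rewrite fin_numE; apply/andP; split; last first.
  rewrite lt_eqF//; apply: le_lt_trans gx0.
  by apply: ereal_inf_lbound; exists x0.
apply/negP => /eqP vN.
(* If the infimum were [-oo], a cluster point of the [eps_n]-minimizers would
   satisfy [g x <= r] for all real [r], which [g_val] forbids. *)
have [[x Lx] H] := @cluster_eps_argmin harmonic (@harmonic_gt0 R) cvg_harmonic.
have [_] := H x Lx; rewrite vN => gle.
have := g_val x; case gx : (g x) gle => [s| |] // gle _.
  by have := gle (s - 1)%R (ltNyr _); rewrite lee_fin lerBrDl gerDr ler10.
by have := gle 0%R (ltNyr _).
Qed.

Lemma cluster_eps_argmin_sub (eps : nat -> R) :
  (forall n, (0 < eps n)%R) -> eps @ \oo --> (0 : R)%R ->
  let L := cluster_points (fun n => eps_argmin (eps n) (g_ n) (C n)) in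
  L !=set0 /\ L `<=` argmin g S.
Proof.
move=> eps0 epsc; have [L0 LS] := cluster_eps_argmin eps0 epsc; split => //.
move=> x /LS[Sx gx]; split => //.
have /fineK <- := value_fin_num; apply/lee_addgt0Pr => e e0.
rewrite -EFinD; apply: gx.
by rewrite -{1}(fineK value_fin_num) lte_fin ltrDl.
Qed.

(** Otherwise the level sets at [a] are nonempty for arbitrarily large [n]; they have a cluster
    point in [S] where [g] is at most [a], below the infimum. *)
Lemma near_value_ge (a : R) : a%:E < value g S ->
  \forall n \near \oo, a%:E <= value (g_ n) (C n).
Proof.
move=> av; apply: contrapT => nH.
pose B n := [set x | C n x /\ g_ n x <= a%:E].
have Bfreq N : exists2 n, (N <= n)%N & B n !=set0.
  apply: contrapT => noN; apply: nH; exists N => // n /= Nn.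
  apply: le_ereal_inf_tmp => _ [y Cy <-]; rewrite leNgt; apply/negP => /ltW ya.
  by apply: noN; exists n => //; exists y.
have BC : \forall n \near \oo, forall y, B n y ->
  C n y /\ g_ n y <= a%:E by near=> n.
have [x xB] := cluster_points_neq0 g_lc BC Bfreq.
have Sx : S x.
  apply: (cluster_points_bigcap C_closed C_nincr _ xB).
  by near=> n; move=> y [].
have : g x <= a%:E.
  by apply: (cluster_points_le g_cvg _ xB); near=> n; move=> y [].
apply/negP; rewrite -ltNge; apply: lt_le_trans av _.
by apply: ereal_inf_lbound; exists x.
Unshelve. all: by end_near. Qed.

Lemma near_value_close (e : R) : (0 < e)%R ->
  \forall n \near \oo, (fine (value g S) - e)%:E <= value (g_ n) (C n) /\
    value (g_ n) (C n) <= (fine (value g S) + e)%:E.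
Proof.
move=> e0; have vE := fineK value_fin_num.
near=> n; split; near: n.
  by apply: near_value_ge; rewrite -[ltRHS]vE lte_fin ltrBlDr ltrDl.
have vlt : value g S < (fine (value g S) + e)%:E.
  by rewrite -[ltLHS]vE lte_fin ltrDl.
(* Any positive null sequence would do: [eps_value] dominates [value], so a bound on the former
   passes to the latter. *)
have := near_eps_value_lt (@harmonic_gt0 R) cvg_harmonic vlt.
apply: filterS => n /ltW; apply: le_trans.
rewrite /eps_value (gt_eqF (harmonic_gt0 n)).
case: ifPn => [/eqP ->|_]; first exact: leNye.
by rewrite leeDl// lee_fin harmonic_ge0.
Unshelve. all: by end_near. Qed.

Lemma value_cvg : (fun n => value (g_ n) (C n)) @ \oo --> value g S.
Proof.
rewrite -(fineK value_fin_num); apply/fine_cvgP; split.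
  apply: filterS (near_value_close ltr01) => n [lo hi].
  by rewrite fin_numElt (lt_le_trans _ lo) ?ltNyr// (le_lt_trans hi) ?ltry.
apply/cvgrPdist_le => e /near_value_close; apply: filterS => n [lo hi] /=.
move: lo hi; case: (value (g_ n) (C n)) => [r| |] //=.
rewrite !lee_fin => lo hi.
by rewrite distrC ler_distl lo.
Qed.

(** A minimizer [x] of [g] itself belongs to the [e]-argmin for large [n]: half of [e] absorbs the
    error of [g_ n x], the other half that of the value. *)
Lemma argmin_sub_liminf (e : R) : (0 < e)%R ->
  argmin g S `<=` PK_liminf (fun n => eps_argmin e (g_ n) (C n)).
Proof.
move=> e0 x [Sx gx]; apply: near_PK_liminf.
have e20 : (0 < e / 2)%R by rewrite divr_gt0.
have gnx : \forall n \near \oo, g_ n x < (fine (value g S) + e / 2)%:E.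
  apply: (@cvg_pointwise x _ (open_ereal_lt' _)); apply: le_lt_trans gx _.
  by rewrite -{1}(fineK value_fin_num) lte_fin ltrDl.
near=> n; split; first exact: Sx.
have [lo _] : (fine (value g S) - e / 2)%:E <= value (g_ n) (C n) /\
    value (g_ n) (C n) <= (fine (value g S) + e / 2)%:E.
  by near: n; exact: near_value_close.
rewrite /eps_value gt_eqF; last by apply: lt_le_trans lo; exact: ltNyr.
apply: (@le_trans _ _ ((fine (value g S) - e / 2)%:E + e%:E)); last first.
  exact: leeD2r.
rewrite -EFinD (_ : (_ - _ + _ = fine (value g S) + e / 2)%R).
  by apply: ltW; near: n.
by rewrite {2}(splitr e) addrA subrK.
Unshelve. all: by end_near. Qed.

(** With tolerance [e / 2] and values within [e / 2] of the limit, [g_ n] is eventually at most the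
    limit value plus [e] on the approximate minimizers; this bound passes to [g x], and [e] is
    arbitrary. *)
Lemma bigcap_cluster_eps_argmin_sub :
  \bigcap_(e in [set e : R | (0 < e)%R])
    cluster_points (fun n => eps_argmin e (g_ n) (C n)) `<=` argmin g S.
Proof.
move=> x xL; split.
  apply: (cluster_points_bigcap C_closed C_nincr _ (xL 1%R ltr01)).
  by near=> n; move=> y [].
have vE := fineK value_fin_num.
rewrite -vE; apply/lee_addgt0Pr => e e0; rewrite -EFinD.
have e20 : (0 < e / 2)%R by rewrite divr_gt0.
apply: (cluster_points_le g_cvg _ (xL _ e20)).
apply: filterS (near_value_close e20) => n [lo hi] y [_].
rewrite /eps_value gt_eqF; last by apply: lt_le_trans lo; exact: ltNyr.
move=> /le_trans; apply; apply: le_trans (leeD2r _ hi) _.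
by rewrite -EFinD -addrA -splitr.
Unshelve. all: by end_near. Qed.

(** A cycle of inclusions: lower limits, upper limits, [argmin g S], lower limits. *)
Lemma bigcap_eps_argmin :
  \bigcap_(e in [set e : R | (0 < e)%R])
    PK_liminf (fun n => eps_argmin e (g_ n) (C n)) = argmin g S /\
  argmin g S = \bigcap_(e in [set e : R | (0 < e)%R])
    PK_limsup (fun n => eps_argmin e (g_ n) (C n)).
Proof.
have inf_sup : \bigcap_(e in [set e : R | (0 < e)%R])
    PK_liminf (fun n => eps_argmin e (g_ n) (C n)) `<=`
  \bigcap_(e in [set e : R | (0 < e)%R])
    PK_limsup (fun n => eps_argmin e (g_ n) (C n)).
  by move=> x xL e e0; apply: PK_liminf_sub_limsup; exact: xL.
have sup_arg : \bigcap_(e in [set e : R | (0 < e)%R])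
    PK_limsup (fun n => eps_argmin e (g_ n) (C n)) `<=` argmin g S.
  move=> x xL; apply: bigcap_cluster_eps_argmin_sub => e e0.
  by rewrite -PK_limsupE; exact: xL.
have arg_inf : argmin g S `<=` \bigcap_(e in [set e : R | (0 < e)%R])
    PK_liminf (fun n => eps_argmin e (g_ n) (C n)).
  by move=> x xS e e0; exact: argmin_sub_liminf.
split; apply/seteqP; split => //.
- exact: subset_trans sup_arg.
- exact: subset_trans inf_sup.
Qed.

End decreasing_constraints.

(** * Countable base and the almost sure constraint set *)

Lemma separable_open_base {R : realType} (X : metricType R) :
  separable_space X ->
  exists U : nat -> set X, (forall i, open (U i)) /\
    forall x V, nbhs x V -> exists2 i, U i x & U i `<=` V.
Proof.
move=> [D /countable_injP[f finj] Dd].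
(* As [f] is injective on [D], each union below has at most one term. *)
pose W (p : nat * nat) : set X :=
  \bigcup_(q in [set q | D q /\ f q = p.1]) (ball q p.2.+1%:R^-1)^°.
exists (fun i => oapp W set0 (unpickle i)); split.
  move=> i; case: unpickle => [p|]/=; last exact: open0.
  by apply: bigcup_open => q _; exact: open_interior.
move=> x V /nbhs_ballP[e /= e0 eV].
have e20 : (0 < e / 2)%R by rewrite divr_gt0.
have [m _ /(_ m (leqnn m)) /= me] := near_infty_natSinv_lt (PosNum e20).
have m0 : (0 < m.+1%:R^-1 :> R)%R by rewrite invr_gt0.
have m20 : (0 < m.+1%:R^-1 / 2 :> R)%R by rewrite divr_gt0.
(* Taking [q] within half the radius of [x] puts [x] in the interior of the ball around [q]; as the
   full radius is below [e / 2], that ball stays inside the [e]-ball around [x]. *)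
have [q [xq Dq]] : (ball x (m.+1%:R^-1 / 2))^° `&` D !=set0.
  apply: Dd; last exact: open_interior.
  by exists x; exact: nbhsx_ballx.
have {}xq := interior_subset xq.
exists (pickle (f q, m)); rewrite pickleK/=.
  exists q => //; apply/nbhs_ballP; exists (m.+1%:R^-1 / 2)%R => //= y xy.
  by rewrite [m.+1%:R^-1%R]splitr; apply: ball_triangle xy; exact: ball_sym.
move=> y [q' [Dq' fq']] /interior_subset qy; apply: eV.
have qq' : q' = q by apply: finj => //; rewrite inE.
rewrite {}qq' in qy; rewrite [e]splitr.
apply: (@ball_triangle _ _ q).
  apply: le_ball xq; apply/ltW; apply: le_lt_trans me.
  by rewrite ler_pdivrMr// ler_peMr ?ler1n// ltW.
by apply: le_ball qy; exact: ltW.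
Qed.

Section almost_sure_set.
Context {R : realType} {X : metricType R} {d : measure_display}.
Context {Xi : measurableType d} (P : probability Xi R) (M : Xi -> set X).
Context (M_closed : forall xi, closed (M xi)).
Context (U : nat -> set X) (U_open : forall i, open (U i)).
Context (U_base : forall x V, nbhs x V -> exists2 i, U i x & U i `<=` V).
Let hit i := [set xi | M xi `&` U i !=set0].

Let mem_of_hits x xi : (forall i, U i x -> hit i xi) -> M xi x.
Proof.
move=> xhit; apply: M_closed => V /U_base[i Uix UV].
by have [y [My Uy]] := xhit i Uix; exists y; split => //; exact: UV.
Qed.

(** The exceptional null set of a point depends on the point, and [as_set P M] may be uncountable.
    One witness per basic open set leaves only countably many null sets, and closedness recovers all
    points. *)
Lemma ae_as_set_sub : {ae P, forall xi, as_set P M `<=` M xi}.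
Proof.
have : {ae P, forall xi i, as_set P M `&` U i !=set0 -> hit i xi}.
  apply: ae_foralln => i.
  have [[y [asy Uy]]|no] := pselect (as_set P M `&` U i !=set0).
    by move: asy; apply: filterS => xi Mxi _; exists y.
  by apply: aeW => xi /no.
apply: filterS => xi Hxi x asx; apply: mem_of_hits => i Uix.
by apply: Hxi; exists x.
Qed.

(** If every basic neighbourhood of [x] were hit with probability 1, then almost surely all would be
    hit at once, placing [x] in the closed set [M xi]. *)
Lemma notin_as_set x : (forall i, measurable (hit i)) -> ~ as_set P M x ->
  exists2 i, U i x & P (hit i) < 1.
Proof.
move=> mhit asx; apply: contrapT => no; apply: asx.
have : {ae P, forall xi i, U i x -> hit i xi}.
  apply: ae_foralln => i.
  have [Uix|nUix] := pselect (U i x); last by apply: aeW => xi /nUix.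
  have Phit : P (hit i) = 1.
    apply/eqP; rewrite eq_le probability_le1//= leNgt.
    by apply/negP => Plt; apply: no; exists i.
  exists (~` hit i); split; [exact: measurableC | | by move=> xi /not_implyP[]].
  by apply: etrans (probability_setC P (mhit i)) _; rewrite Phit subee.
by apply: filterS => xi; exact: mem_of_hits.
Qed.

End almost_sure_set.

(** * Coordinates under the product measure *)

Section denumerable_product.
Context {R : realType} {d : measure_display} {Xi : measurableType d}.
Context (P : probability Xi R) (Pinf : probability (sequence_space Xi) R).
Context (PinfE : is_denumerable_product P Pinf).

Lemma measurable_coordinate k (A : set Xi) : measurable A ->
  measurable ([set w | A (w k)] : set (sequence_space Xi)).
Proof. by move=> mA; apply: sub_sigma_algebra; exists k, A. Qed.

Lemma product_coordinate k (A : set Xi) : measurable A ->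
  Pinf [set w : nat -> Xi | A (w k)] = P A.
Proof.
(* The cylinder is a box with [k.+1] factors, all full except the last. *)
move=> mA; pose B i := if i == k then A else setT.
have mB i : measurable (B i) by rewrite /B; case: ifP.
have := PinfE k.+1 mB; rewrite (bigD1 ord_max)//= big1 => [|i ik].
  rewrite mule1 /B eqxx => <-; congr (Pinf _); apply/seteqP; split => w /=.
    by move=> Aw i _; case: eqP => // ->.
  by move=> /(_ k (ltnSn k)); rewrite eqxx.
have -> : B i = setT.
  by rewrite /B ifN//; apply: contraNneq ik => ik; apply/eqP/val_inj.
exact: probability_setT.
Qed.

Lemma ae_coordinate k (Q : set Xi) : {ae P, forall xi, Q xi} ->
  {ae Pinf, forall w : sequence_space Xi, Q (w k)}.
Proof.
move=> [N [mN N0 QN]]; exists [set w | N (w k)]; split.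
- exact: measurable_coordinate.
- by rewrite -N0; exact: product_coordinate.
- by move=> w nQ; exact: QN.
Qed.

(** The event that all coordinates fall in [A] lies in a box of probability [P A] to the power [n],
    for every [n], hence is null. *)
Lemma ae_exists_coordinate (A : set Xi) : measurable A -> P A < 1 ->
  {ae Pinf, forall w : sequence_space Xi, exists k, ~ A (w k)}.
Proof.
move=> mA PA1; pose N : set (sequence_space Xi) := \bigcap_k [set w | A (w k)].
have mN : measurable N.
  by apply: bigcapT_measurable => k; exact: measurable_coordinate.
have PAfin : P A \is a fin_num by exact: fin_num_measure.
have PNfin : Pinf N \is a fin_num by exact: fin_num_measure.
have NX n : (fine (Pinf N) <= fine (P A) ^+ n)%R.
  rewrite -lee_fin EFin_expe !fineK//.
  have := PinfE n (fun=> mA); rewrite big_const_ord iter_mule mule1 => <-.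
  apply: le_measure; rewrite ?inE//.
    rewrite (_ : [set _ | _] =
      \bigcap_(k in [set k | (k < n)%N]) [set w | A (w k)]).
      by apply: bigcap_measurableType => k _; exact: measurable_coordinate.
    by apply/seteqP; split.
  by move=> w Nw k _; exact: Nw.
exists N; split => //.
  rewrite -(fineK PNfin); congr (_%:E); apply/eqP.
  rewrite eq_le fine_ge0 ?measure_ge0// andbT.
  have PA0 : (`|fine (P A)| < 1)%R.
    by rewrite ger0_norm ?fine_ge0 ?measure_ge0// -lte_fin fineK.
  by apply: cvgr_to_ge (cvg_expr PA0) _; near=> n; exact: NX.
by move=> w /= /forallNP nw k _; apply: contrapT => nA; exact: nw nA.
Unshelve. all: by end_near. Qed.

End denumerable_product.

(** * Reduction to the deterministic case on an event of full probability *)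

Unset Implicit Arguments.
Set Strict Implicit.

Theorem corollary4p1 (R : realType) (X : metricType R)
    (Xcomplete : complete_space X) (Xseparable : separable_space X)
    (d : measure_display) (Xi : measurableType d) (P : probability Xi R)
    (Pcomplete : measure_is_complete P)
    (Pinf : probability (sequence_space Xi) R)
    (PinfE : is_denumerable_product P Pinf)
    (M : Xi -> set X) (Mmeas : measurable_multifunction M)
    (Mclosed : forall xi, closed (M xi))
    (g : X -> \bar R) (g_val : avoids_ninfty g)
    (g_lsc : lower_semicontinuous g)
    (g_ : nat -> X -> \bar R) (gn_val : forall n, avoids_ninfty (g_ n))
    (gn_lsc : forall n, lower_semicontinuous (g_ n))
    (gn_cvg : converges_continuously g_ g)
    (feasible : exists2 x, as_set P M x & g x < +oo)
    (level_compact : {ae Pinf, forall w,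
       eventually_level_compact g_ (sampled_set M w)}) :
  [/\ {ae Pinf, forall w,
         (fun n => value (g_ n) (sampled_set M w n)) @ \oo -->
         value g (as_set P M)},
      forall eps : nat -> sequence_space Xi -> R,
        (forall n, measurable_fun setT (eps n)) ->
        (forall n w, (0 < eps n w)%R) ->
        {ae Pinf, forall w, (fun n => eps n w) @ \oo --> (0 : R)%R} ->
        {ae Pinf, forall w,
          let L := PK_limsup
            (fun n => eps_argmin (eps n w) (g_ n) (sampled_set M w n)) in
          L !=set0 /\ L `<=` argmin g (as_set P M)} &
      {ae Pinf, forall w,
        \bigcap_(e in [set e : R | (0 < e)%R])
          PK_liminf (fun n => eps_argmin e (g_ n) (sampled_set M w n)) =
        argmin g (as_set P M) /\
        argmin g (as_set P M) =
        \bigcap_(e in [set e : R | (0 < e)%R])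
          PK_limsup (fun n => eps_argmin e (g_ n) (sampled_set M w n))}].
Proof.
have [U [U_open U_base]] := separable_open_base Xseparable.
pose hit i := [set xi | M xi `&` U i !=set0].
have mhit i : measurable (hit i) by exact: Mmeas.
have sampledE : {ae Pinf, forall w : sequence_space Xi,
      \bigcap_n sampled_set M w n = as_set P M}.
  have sub : {ae Pinf, forall (w : sequence_space Xi) k,
      as_set P M `<=` M (w k)}.
    apply: ae_foralln => k.
    exact: (ae_coordinate PinfE k (ae_as_set_sub P Mclosed U_base)).
  have miss : {ae Pinf, forall (w : sequence_space Xi) i,
      P (hit i) < 1 -> exists k, ~ hit i (w k)}.
    apply: ae_foralln => i; have [Pi|Pi] := pselect (P (hit i) < 1).
      by apply: filterS (ae_exists_coordinate PinfE (mhit i) Pi).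
    by apply: aeW => w /Pi.
  apply: filterS2 sub miss => w sub miss; apply/seteqP; split => x; last first.
    by move=> asx n _ k _; exact: sub.
  move=> Sx; apply: contrapT => asx.
  have [i Uix /miss[k]] := notin_as_set Mclosed U_base mhit asx.
  (* The sample [w k] first constrains [sampled_set] at index [k.+1], so [x] lies in [M (w k)] and
     would itself witness the excluded hit. *)
  by apply; exists x; split => //; exact: (Sx k.+1 I k (ltnSn k)).
have sampled_closed w n : closed (sampled_set M w n).
  by apply: closed_bigI => k _; exact: Mclosed.
have sampled_nincr w m n : (m <= n)%N ->
  sampled_set M w n `<=` sampled_set M w m.
  by move=> mn x Sx k /= km; apply: Sx; exact: leq_trans mn.
have feasible_sampled w : \bigcap_n sampled_set M w n = as_set P M ->
  exists2 x, (\bigcap_n sampled_set M w n) x & g x < +oo by move=> ->.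
split.
- apply: filterS2 sampledE level_compact => w SE lc; rewrite -SE.
  exact: value_cvg gn_cvg g_val (sampled_closed w) (sampled_nincr w) lc
    (feasible_sampled w SE).
- move=> eps _ eps0 epsc; apply: filterS3 sampledE level_compact epsc.
  move=> w SE lc epsc; rewrite PK_limsupE -SE.
  exact: (cluster_eps_argmin_sub gn_cvg g_val (sampled_closed w)
    (sampled_nincr w) lc (feasible_sampled w SE) (eps0^~ w) epsc).
- apply: filterS2 sampledE level_compact => w SE lc; rewrite -SE.
  exact: bigcap_eps_argmin gn_cvg g_val (sampled_closed w) (sampled_nincr w) lc
    (feasible_sampled w SE).
Qed.
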